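(* Let $F$ be a field of finite (prime) characteristic $p$, let $A=(a_{ij})_{1\le i,j\le 3}$ be a $3\times 3$ matrix with entries in $F$, and let $R=(R_{ij})_{1\le i,j\le 3}$ be the $p\times p\times p$ block made of copies of $A$. Then the Jordan form of the product $R_{12}R_{23}R_{31}$ (an operator in the first thick space $\mathbf V_1$, of dimension $p^2$) consists of cells with eigenvalue $a_{12}^p a_{23}^p a_{31}^p$, their total dimension (algebraic multiplicity of this eigenvalue) being $\frac{p(p+1)}{2}$, and cells with eigenvalue $a_{13}^p a_{32}^p a_{21}^p$, their total dimension being $\frac{p(p-1)}{2}$. Moreover, if $a_{12}a_{23}a_{31}\ne a_{13}a_{32}a_{21}$, then $R_{12}R_{23}R_{31}$ is diagonalizable, i.e. all its Jordan cells have dimension one.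
   Context: Conventions: vectors are rows and operators/matrices act from the right, so in a product the leftmost factor is applied first. Block. Let $C=\{\mathbf x\in\mathbb Z^3: 0\le x_i\le p-1\}$. To every straight line that is parallel to the $i$-th coordinate axis and passes through points of $C$ attach a copy of the one-dimensional space $V_i=F$. To every $\mathbf x\in C$ attach a copy $A^{(\mathbf x)}$ of $A$ acting in the direct sum of the copies of $V_1,V_2,V_3$ attached to the three lines meeting at $\mathbf x$, extended by the identity to all the other copies. The $p\times p\times p$ block is $R=\prod_{\mathbf x\in C}A^{(\mathbf x)}$, taken in any order such that $A^{(\mathbf x)}$ stands to the left of $A^{(\mathbf y)}$ whenever $\mathbf x\ne\mathbf y$ and $x_i\le y_i$ for all $i$ (the result does not depend on the choice of such an order). Thick spaces. $\mathbf V_i$ is the direct sum of the $p^2$ copies of $V_i$ attached to the lines parallel to the $i$-th axis. $R$ acts in $\mathbf V_1\oplus\mathbf V_2\oplus\mathbf V_3$, and $R_{ij}:\mathbf V_i\to\mathbf V_j$ are its blocks, so that $(v_1,v_2,v_3)R$ has $j$-th component $\sum_i v_iR_{ij}$. The product $R_{12}R_{23}R_{31}$ sends $v\in\mathbf V_1$ to $((vR_{12})R_{23})R_{31}\in\mathbf V_1$. *)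

(* Defs.v *)
From mathcomp Require Import all_boot all_order all_algebra.

Set Implicit Arguments.
Unset Strict Implicit.
Unset Printing Implicit Defensive.

Import GRing.Theory.
Local Open Scope ring_scope.

(* Coordinate axes are numbered 0, 1, 2. Vectors are rows and matrices act on
   the right. *)

Definition point (p : nat) : finType := {ffun 'I_3 -> 'I_p}.

(* A line parallel to the i-th axis and meeting the cube is determined by the
   two coordinates other than the i-th one: [j : 'I_2] stands for the axis
   [lift i j]. *)
Definition thick_index (p : nat) : finType := {ffun 'I_2 -> 'I_p}.

Definition line (p : nat) : finType := ('I_3 * thick_index p)%type.

Definition line_through (p : nat) (i : 'I_3) (x : point p) : line p :=
  (i, [ffun j : 'I_2 => x (lift i j)]).

Definition passes (p : nat) (l : line p) (x : point p) : bool :=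
  l == line_through l.1 x.

(* The coordinates of the direct sum of all the one-dimensional spaces attached
   to the lines are numbered by [enum_rank : line p -> 'I_#|line p|]. *)
Definition local_op (F : fieldType) (p : nat) (A : 'M[F]_3) (x : point p) :
    'M[F]_#|line p| :=
  \matrix_(a, b)
    let l := enum_val a in let m := enum_val b in
    if passes l x && passes m x then A l.1 m.1 else (l == m)%:R.

Definition compatible_order (p : nat) (s : seq (point p)) : Prop :=
  perm_eq s (enum (point p)) /\
  (forall x y : point p, x != y -> (forall i, (x i <= y i)%N) ->
     (index x s < index y s)%N).

(* The product is independent of the compatible order, so this predicate
   determines R. *)
Definition is_block (F : fieldType) (p : nat) (A : 'M[F]_3)
    (R : 'M[F]_#|line p|) : Prop :=
  exists2 s : seq (point p), compatible_order s &
    R = \big[mulmx/1%:M]_(x <- s) local_op A x.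

Lemma compatible_order_exists (p : nat) :
  exists s : seq (point p), compatible_order s.
Proof.
pose w (x : point p) := (\sum_i x i)%N.
pose r (x y : point p) := (w x <= w y)%N.
exists (sort r (enum (point p))); split; first by rewrite perm_sort.
move=> x y nxy lexy; rewrite ltnNge; apply/negP => le_idx.
have r_tr : transitive r by move=> b a c; apply: leq_trans.
have r_tot : total r by move=> a b; apply: leq_total.
have wyx : r y x.
  apply: (sorted_leq_index r_tr _ (sort_sorted r_tot _)) le_idx.
  - by move=> a; apply: leqnn.
  - by rewrite mem_sort mem_enum.
  - by rewrite mem_sort mem_enum.
case/negP: nxy; apply/eqP/ffunP => i; apply/val_inj/eqP.
rewrite /= eqn_leq lexy /=.
have le_rest : (\sum_(j | j != i) x j <= \sum_(j | j != i) y j)%N.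
  by apply: leq_sum => j _.
move: wyx; rewrite /r /w (bigD1 i) //= [leqRHS](bigD1 i) //= => wyx.
rewrite -(leq_add2r (\sum_(j | j != i) y j)%N).
by apply: leq_trans wyx _; rewrite leq_add2l.
Qed.

Definition thick_block (F : fieldType) (p : nat) (R : 'M[F]_#|line p|)
    (i j : 'I_3) : 'M[F]_#|thick_index p| :=
  \matrix_(a, b) R (enum_rank (i, enum_val a : thick_index p))
                   (enum_rank (j, enum_val b : thick_index p)).

Definition jordan_cell (F : fieldType) (a : F) (n : nat) : 'M[F]_n :=
  \matrix_(i, j) (if i == j then a else (i.+1 == j :> nat)%:R).

(* A cell is given by its eigenvalue and its size. *)
Definition jordan_mx (F : fieldType) (cs : seq (F * nat)) :=
  \mxdiag_(i < size cs)
    jordan_cell (tnth (in_tuple cs) i).1 (tnth (in_tuple cs) i).2.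

(* [P] is allowed to be formally rectangular because the sizes of the cells add
   up to [n] only propositionally; [row_free] and [row_full] together force the
   two dimensions to agree and [P] to be invertible. *)
Definition jordan_form (F : fieldType) (n : nat) (M : 'M[F]_n)
    (cs : seq (F * nat)) : Prop :=
  all (fun c : F * nat => (0 < c.2)%N) cs /\
  exists2 P : 'M[F]_(_, n), row_free P && row_full P & M ~_P (jordan_mx cs).

(* Main.v *)
Require Import Defs.
From mathcomp Require Import all_boot all_order all_algebra.
From mathcomp Require Import zify ring.
Import GRing.Theory.
Local Open Scope ring_scope.
Set Implicit Arguments.
Unset Strict Implicit.
Unset Printing Implicit Defensive.

(** Number the axes by i, j, k, put U = diag (u_0, u_1, u_2), let
    N = adj (1 - A U) and D = det (1 - A U), and encode a vector of the i-th
    thick space as a polynomial f of degree less than p in each of u_j and u_k.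

    _The blocks._  The amplitudes on all edges of the infinite lattice fed by f
    have generating function f N_i / D.  In characteristic p,
    1 / D = D^(p-1) / D^p, and D^p is 1 modulo the p-th powers of the
    variables, so inside the cube 1 / D can be replaced by D^(p-1).  Reading off
    the outgoing faces ([thick_step]), f R_ij is the coefficient of u_j^(p-1) in
    s_ij f D^(p-1), truncated modulo u_k^p, where N_ij = u_j s_ij (u_k).  Now
    D = al - be u_j with al, be free of u_j, and in characteristic p this
    coefficient is s_ij be^(p-1) f (al / be) ([coef_homog]): up to a factor,
    R_ij is the elimination of u_j through the equation D = 0.

    _The eigenvectors._  On the surface D = 0 the matrix N has rank one.
    Eliminating u_j therefore turns row i of N into s_ij times row j of N, and
    a monomial of degree p - 1 in the entries of row i becomes s_ij^p times the
    same monomial in row j.  Modulo u_k^p, s_ij^p is the constant a_ij^p.  After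
    the three steps i -> j -> k -> i the monomial comes back multiplied by
    a_01^p a_12^p a_20^p ([row_monomial_step]).  There are p (p + 1) / 2 such
    monomials.  In the same way the columns of N give p (p - 1) / 2 vectors,
    monomials of degree p - 2 times a fixed product of two factors, with
    eigenvalue a_10^p a_21^p a_02^p ([col_monomial_step]).

    _Genericity._  For the cyclic permutation matrix these p^2 vectors are the
    monomials, hence a basis.  Joining A to that matrix by a line A_t
    over F[t], they form a basis over F(t), so that the product M_t satisfies
    (M_t - lam) (M_t - mu) = 0, rank (M_t - lam) <= p (p - 1) / 2 and
    rank (M_t - mu) <= p (p + 1) / 2.  These conditions are closed, so they hold
    for A itself ([monodromy_spectrum]).  If lam and mu differ, they make M
    diagonalizable with the right multiplicities.  If lam = mu, then M - lam
    squares to zero, its cells have size at most two, and the rank bound leaves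
    at least p of size one, enough to distribute the cells into two groups of
    the required total sizes ([jordan_square_zero]). *)

(** * Jordan forms from chains of vectors *)
Lemma map_constant (S T : Type) (c : T) (s : seq S) : [seq c | _ <- s] = nseq (size s) c.
Proof. by elim: s => //= _ s ->. Qed.

Section JordanChains.
Variables (F : fieldType) (N : nat) (M : 'M[F]_N).

(** An eigenvalue with rows v, v (M - a), v (M - a)^2, and so on.  The number of
    rows is packed with the matrix so that chains of different lengths can
    be put into one list. *)
Definition chain := (F * {n & 'M[F]_(n, N)})%type.

Definition is_chain (b : chain) : bool :=
  (0 < tag b.2)%N &&
  (tagged b.2 *m M == jordan_cell b.1 (tag b.2) *m tagged b.2).

(** Stacking the chains gives the change of basis: it is onto because the chains
    span, and square because their lengths add up to the dimension. *)
Lemma jordan_form_of_chains (bl : seq chain) :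
  all is_chain bl -> (1%:M <= \sum_(b <- bl) <<tagged b.2>>)%MS ->
  (\sum_(b <- bl) tag b.2)%N = N ->
  jordan_form M [seq (b.1, tag b.2) | b <- bl].
Proof.
move=> ch_bl full_bl dim_bl; set cs := map _ _.
pose b0 : chain := (0, Tagged (fun n => 'M[F]_(n, N)) (0 : 'M[F]_(0, N))).
have cs_nth (i : 'I_(size cs)) :
    tnth (in_tuple cs) i = ((nth b0 bl i).1, tag (nth b0 bl i).2).
  by rewrite (tnth_nth (b0.1, 0%N)) (nth_map b0) // -(size_map (fun b : chain => (b.1, tag b.2))).
(* The length of the i-th chain and the size of the i-th cell are equal only
   propositionally; [conform_mx] transports the matrix without a cast. *)
pose P (i : 'I_(size cs)) : 'M[F]_((tnth (in_tuple cs) i).2, N) :=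
  conform_mx 0 (tagged (nth b0 bl i).2).
have conf n (b : chain) : n = tag b.2 ->
    (conform_mx (0 : 'M_(n, N)) (tagged b.2) :=: tagged b.2)%MS /\
    (is_chain b -> conform_mx (0 : 'M_(n, N)) (tagged b.2) *m M
      = jordan_cell b.1 n *m conform_mx 0 (tagged b.2)).
  by move=> ->; rewrite conform_mx_id; split=> // /andP[_ /eqP].
have sz_cs : size cs = size bl by rewrite size_map.
have chP i : P i *m M = jordan_cell (tnth (in_tuple cs) i).1 _ *m P i.
  have e : (tnth (in_tuple cs) i).2 = tag (nth b0 bl i).2 by rewrite cs_nth.
  have := (conf _ _ e).2; rewrite /P => ->; first by rewrite cs_nth.
  by apply: (all_nthP b0 ch_bl); rewrite -sz_cs.
have fullP : row_full (\mxcol_i P i).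
  rewrite -sub1mx (submx_trans full_bl) // eqmx_col.
  rewrite (big_nth b0) -sz_cs big_mkord; apply/sumsmx_subP => i _.
  rewrite (sumsmx_sup i) // !genmxE.
  by rewrite (conf _ _ _).1 ?cs_nth.
have dimP : (\sum_(i < size cs) (tnth (in_tuple cs) i).2)%N = N.
  rewrite -[RHS]dim_bl (big_nth b0) -sz_cs big_mkord.
  by apply: eq_bigr => i _; rewrite cs_nth.
have freeP : row_free (\mxcol_i P i).
  by rewrite /row_free (eqP fullP) eq_sym; apply/eqP.
split.
  rewrite /cs all_map; apply: sub_all ch_bl => b /andP[] //.
exists (\mxcol_i P i); first by rewrite freeP.
apply: similarW => //; rewrite mul_mxdiag_mxcol mxcol_mul.
by apply: eq_mxcol.
Qed.

(** Eigenvectors are chains of length one. *)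
Definition eigen_chains (a : F) k (W : 'M[F]_(k, N)) : seq chain :=
  [seq (a, Tagged (fun n => 'M[F]_(n, N)) (row i W)) | i : 'I_k].

Lemma jordan_cell1 (a : F) : jordan_cell a 1 = a%:M.
Proof. by apply/matrixP => i j; rewrite !mxE !ord1. Qed.

Lemma eigen_chainsP (a : F) k (W : 'M[F]_(k, N)) :
  W *m M = a *: W -> all is_chain (eigen_chains a W).
Proof.
move=> eW; rewrite all_map; apply/allP => i _ /=; rewrite /is_chain /=.
by rewrite jordan_cell1 mul_scalar_mx -row_mul eW linearZ.
Qed.

Lemma eigen_chains_span (a : F) k (W : 'M[F]_(k, N)) :
  (W <= \sum_(b <- eigen_chains a W) <<tagged b.2>>)%MS.
Proof.
apply/row_subP => i; rewrite big_map big_enum /=.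
by rewrite (sumsmx_sup i) // genmxE.
Qed.

Lemma eigen_chains_cells (a : F) k (W : 'M[F]_(k, N)) :
  [seq (b.1, tag b.2) | b <- eigen_chains a W] = [seq (a, x) | x <- nseq k 1%N].
Proof.
by rewrite -map_comp map_nseq (map_constant (a, 1%N)) size_enum_ord.
Qed.

Lemma eigen_chains_dim (a : F) k (W : 'M[F]_(k, N)) :
  (\sum_(b <- eigen_chains a W) tag b.2)%N = k.
Proof. by rewrite big_map big_enum /= sum1_card card_ord. Qed.

Definition pair_chains (a : F) k (V : 'M[F]_(k, N)) : seq chain :=
  [seq (a, Tagged (fun n => 'M[F]_(n, N))
             (col_mx (row i V) (row i V *m (M - a%:M)))) | i : 'I_k].

Lemma pair_chainsP (a : F) k (V : 'M[F]_(k, N)) :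
  (M - a%:M) *m (M - a%:M) = 0 -> all is_chain (pair_chains a V).
Proof.
move=> sq0; rewrite all_map; apply/allP => i _ /=; rewrite /is_chain /=.
set v := row i V; set X := M - a%:M in sq0 *.
have -> : jordan_cell a 2 = block_mx (a%:M : 'M_1) 1%:M 0 (a%:M : 'M_1).
  apply/matrixP => x y; rewrite !mxE -val_eqE /=.
  by case: splitP => x' ->; rewrite !mxE; case: splitP => y' ->;
     rewrite !mxE !ord1 /= ?mulr1n.
have defM : M = X + a%:M by rewrite subrK.
clearbody X; rewrite defM.
rewrite mul_col_mx mul_block_col !mulmxDr -mulmxA sq0 mulmx0 !mul_mx_scalar.
by rewrite !mul_scalar_mx mul0mx scale1r !add0r addrC.
Qed.

(** [pair_chains a V] are the chains of length two starting at the rows of [V];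
    the two summands are their first and second vectors. *)
Lemma pair_chains_span (a : F) k (V : 'M[F]_(k, N)) :
  (V + V *m (M - a%:M) <= \sum_(b <- pair_chains a V) <<tagged b.2>>)%MS.
Proof.
rewrite big_map big_enum /= addsmx_sub; apply/andP; split; apply/row_subP => i.
  rewrite (sumsmx_sup i) // genmxE.
  by apply: submx_trans (addsmxSl _ _) _; rewrite addsmxE.
rewrite row_mul (sumsmx_sup i) // genmxE.
by apply: submx_trans (addsmxSr _ _) _; rewrite addsmxE.
Qed.

Lemma pair_chains_cells (a : F) k (V : 'M[F]_(k, N)) :
  [seq (b.1, tag b.2) | b <- pair_chains a V] = [seq (a, x) | x <- nseq k 2%N].
Proof.
by rewrite -map_comp map_nseq (map_constant (a, 2%N)) size_enum_ord.
Qed.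

End JordanChains.

Section QuadraticRelation.
Variables (F : fieldType) (N n m : nat) (M : 'M[F]_N) (a b : F).
Hypothesis dimN : N = (n + m)%N.
Hypothesis rk_a : (\rank (M - a%:M)%R <= m)%N.

(** The rank bounds make the two eigenspaces of dimension at least [n] and [m].
    They are independent, and [n + m] is the whole dimension, so both bounds are
    attained and the eigenspaces fill the space. *)
Lemma jordan_two_eigenvalues : (\rank (M - b%:M)%R <= n)%N -> a != b ->
  jordan_form M ([seq (a, x) | x <- nseq n 1%N] ++ [seq (b, x) | x <- nseq m 1%N])
  /\ diagonalizable M.
Proof.
move=> rk_b nab; pose Ea := eigenspace M a; pose Eb := eigenspace M b.
have dir : mxdirect (Ea + Eb).
  have := @mxdirect_sum_eigenspace F bool N M predT (fun i : bool => if i then a else b).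
  move=> /(_ _)/mxdirectP; rewrite /= !big_bool /= => dab.
  apply/mxdirectP => /=; apply: dab => x y _ _.
  by case: x y => [] [] // e; move: nab; rewrite e eqxx.
have rkEa : (n <= \rank Ea)%N by rewrite mxrank_ker; move: rk_a; set r := \rank _ => ?; lia.
have rkEb : (m <= \rank Eb)%N by rewrite mxrank_ker; move: rk_b; set r := \rank _ => ?; lia.
have rkE : (\rank (Ea + Eb) = \rank Ea + \rank Eb)%N by apply/mxdirectP.
have := rank_leq_col (Ea + Eb)%MS; rewrite rkE => leN.
have rEa : \rank Ea = n by lia.
have rEb : \rank Eb = m by lia.
have full : (1%:M <= Ea + Eb)%MS by rewrite sub1mx /row_full rkE; apply/eqP; lia.
split.
  rewrite -{1}rEa -{1}rEb -(eigen_chains_cells a (row_base Ea)).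
  rewrite -(eigen_chains_cells b (row_base Eb)) -map_cat.
  apply: jordan_form_of_chains.
  - rewrite all_cat !eigen_chainsP //.
    + by apply/eigenspaceP; rewrite eq_row_base.
    + by apply/eigenspaceP; rewrite eq_row_base.
  - rewrite big_cat /= (submx_trans full) // addsmxS //.
    + by apply: submx_trans (eigen_chains_span _ _); rewrite eq_row_base.
    + by apply: submx_trans (eigen_chains_span _ _); rewrite eq_row_base.
  - rewrite big_cat /= !eigen_chains_dim; lia.
apply/diagonalizablePeigen; exists [:: a; b]; first by rewrite /= inE nab.
apply/eqmxP; rewrite submx1 (submx_trans full) //.
by rewrite !big_cons big_nil addsmxS // addsmxSl.
Qed.

(** With X = M - a and r = rank X there are r cells of size two and N - 2 r of
    size one.  Since r <= m, the latter are at least n - m >= 2 in number, enough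
    to correct the parity of both sums. *)
Lemma jordan_square_zero : a = b -> (M - a%:M) *m (M - b%:M) = 0 ->
  (m + 2 <= n)%N -> exists s t : seq nat,
  [/\ sumn s = n, sumn t = m &
      jordan_form M ([seq (a, x) | x <- s] ++ [seq (b, x) | x <- t])].
Proof.
move=> <-; set X := M - a%:M => sq0 lemn.
have imker : (X <= kermx X)%MS by apply/sub_kermxP.
(* The rows of [V] lift a basis of the image of [X]: they start the chains of
   length two.  Since the image lies in the kernel, a complement [C] of the
   image in the kernel supplies the chains of length one. *)
have /submxP[V defV] : (row_base X <= X)%MS by rewrite eq_row_base.
have /submxP[D defX] : (X <= row_base X)%MS by rewrite eq_row_base.
pose C := (kermx X :\: X)%MS.
have rkC : (\rank C + 2 * \rank X = N)%N.
  have := mxrank_cap_compl (kermx X) X.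
  by rewrite (capmx_idPr imker) mxrank_ker -/C; have := rank_leq_row X; lia.
have kerE : (kermx X <= X + C)%MS.
  by rewrite -(addsmx_diff_cap_eq (kermx X) X) addsmxC addsmxS // capmxSr.
have full : (1%:M <= (V + V *m X) + row_base C)%MS.
  have -> : 1%:M = D *m V + (1%:M - D *m V) :> 'M_N by rewrite addrC subrK.
  rewrite addmx_sub //.
    by apply: submx_trans (addsmxSl _ _); apply: submx_trans (addsmxSl _ _); rewrite submxMl.
  have : (1%:M - D *m V <= kermx X)%MS.
    by apply/sub_kermxP; rewrite mulmxBl mul1mx -mulmxA -defV -defX subrr.
  move/submx_trans; apply; apply: submx_trans kerE _; apply: addsmxS.
    by apply: submx_trans (addsmxSr _ _); rewrite -defV eq_row_base.
  by rewrite eq_row_base.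
pose tw := pair_chains M a V; pose on := eigen_chains a (row_base C).
have ctw : all (is_chain M) tw by apply: pair_chainsP.
have con : all (is_chain M) on.
  apply: eigen_chainsP; apply/eigenspaceP; rewrite eq_row_base.
  by rewrite /eigenspace -/X diffmxSl.
(* Fill the second group with as many pairs as fit into [m], then with single
   vectors; everything else goes to the first group. *)
pose k := minn (\rank X) (m %/ 2).
pose l := (m - 2 * k)%N.
pose T := take k tw ++ take l on; pose S := drop k tw ++ drop l on.
have pST : perm_eq (S ++ T) (tw ++ on).
  rewrite perm_catC /T /S -{3}(cat_take_drop k tw) -{3}(cat_take_drop l on).
  by rewrite -!catA perm_cat2l perm_catCA.
have cell B : (forall x, x \in B -> x.1 = a) ->
    [seq (x.1, tag x.2) | x <- B] = [seq (a, y) | y <- [seq tag x.2 | x : chain F N <- B]].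
  by move=> aB; rewrite -map_comp; apply/eq_in_map => x /aB /= ->.
have aT : forall x, x \in tw ++ on -> x.1 = a.
  by move=> x; rewrite mem_cat => /orP[]/mapP[i _ ->].
have stw : [seq tag x.2 | x <- tw] = nseq (\rank X) 2%N.
  have := congr1 (map snd) (pair_chains_cells M a V).
  by rewrite -!map_comp /= map_id => <-.
have son : [seq tag x.2 | x <- on] = nseq (\rank C) 1%N.
  have := congr1 (map snd) (eigen_chains_cells a (row_base C)).
  by rewrite -!map_comp /= map_id => <-.
exists [seq tag x.2 | x <- S], [seq tag x.2 | x <- T].
have sT : sumn [seq tag x.2 | x <- T] = m.
  have rX : (\rank X <= m)%N := rk_a.
  have lel : (l <= \rank C)%N by rewrite /l /k; lia.
  by rewrite map_cat !map_take stw son sumn_cat !take_nseq ?geq_minl ?sumn_nseq //; lia.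
have sST : sumn [seq tag x.2 | x <- S ++ T] = N.
  rewrite (perm_sumn (perm_map _ pST)) map_cat sumn_cat stw son !sumn_nseq; lia.
split=> //; first by move: sST; rewrite map_cat sumn_cat sT; lia.
rewrite -!cell => [||x xS]; rewrite -?map_cat.
- apply: jordan_form_of_chains.
  + by rewrite (perm_all _ pST) all_cat ctw con.
  + rewrite (perm_big _ pST) big_cat /= (submx_trans full) // addsmxS //.
      exact: pair_chains_span.
    exact: eigen_chains_span.
  + by move: sST; rewrite sumnE big_map.
- by move=> x xT; apply: aT; rewrite -(perm_mem pST) mem_cat xT orbT.
- by apply: aT; rewrite -(perm_mem pST) mem_cat xS.
Qed.

End QuadraticRelation.

(** * Rank under specialization *)
Lemma exists_unit_minor (F : fieldType) m n (X : 'M[F]_(m, n)) :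
  exists (f : 'I_(\rank X) -> 'I_m) (g : 'I_(\rank X) -> 'I_n),
    mxsub f g X \in unitmx.
Proof.
pose f := maxrankfun X.
have full : row_full (rowsub f X)^T.
  by rewrite /row_full mxrank_tr; apply: maxrowsub_free.
exists f, (fullrankfun full); rewrite -unitmx_tr.
have := fullrowsub_unit full; congr (_ \in unitmx).
by apply/matrixP => i j; rewrite !mxE.
Qed.

Lemma unit_minor_rank (F : fieldType) m n r (X : 'M[F]_(m, n)) f g :
  mxsub f g X \in (unitmx : {pred 'M_r}) -> (r <= \rank X)%N.
Proof.
move=> u; have rk : \rank (mxsub f g X : 'M_r) = r by apply: mxrank_unit.
rewrite -{1}rk; have -> : mxsub f g X = colsub g (rowsub f X).
  by apply/matrixP => i j; rewrite !mxE.
rewrite -mxrank_tr; apply: (@leq_trans (\rank (rowsub f X)^T)).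
  apply: mxrankS; rewrite trmx_mxsub; exact: rowsub_sub.
by rewrite mxrank_tr mxrankS // rowsub_sub.
Qed.

Lemma mxrank_diag_le (F : fieldType) n (d : 'rV[F]_n) :
  (\rank (diag_mx d) <= #|[pred i | (d ord0 i != 0)%R]|)%N.
Proof.
rewrite diag_mx_sum_delta -sum1_card [leqRHS]big_mkcond /=.
apply: (big_ind2 (fun (X : 'M_n) k => (\rank X <= k)%N)) => [|X x Y y leX leY|i _].
  by rewrite mxrank0.
  by apply: leq_trans (mxrank_add _ _) _; apply: leq_add.
rewrite inE; case: eqP => [->|_] /=; first by rewrite scale0r mxrank0.
by apply: leq_trans (mxrankS (scalemx_sub _ (submx_refl _))) _; rewrite mxrank_delta.
Qed.

Section Specialization.
Variables (F : fieldType).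
Local Notation spec x := (map_mx (horner_eval x)).

(** A minor of the specialized matrix is the specialization of a minor: if it is
    nonzero, so is the original one. *)
Lemma mxrank_specialize m n (X : 'M[{poly F}]_(m, n)) x :
  (\rank (spec x X) <= \rank (map_mx (@tofrac {poly F}) X))%N.
Proof.
have [f [g]] := exists_unit_minor (spec x X).
rewrite -map_mxsub unitmxE det_map_mx unitfE => nz.
apply: (unit_minor_rank (f := f) (g := g)).
rewrite -map_mxsub unitmxE det_map_mx unitfE tofrac_eq0.
by apply: contraNneq nz => ->; rewrite rmorph0.
Qed.

(* The rows of [B] are eigenvectors of [M], a basis at the point [x0].  At [x]
   they may become dependent, but bounds on ranks and polynomial relations
   survive. *)
Variables (N : nat) (M B : 'M[{poly F}]_N) (P : pred 'I_N) (a b : {poly F}).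
Hypothesis eig_rel : B *m M = diag_mx (\row_i if P i then a else b) *m B.
Variable x0 : F.
Hypothesis detB : \det (spec x0 B) != 0.
Variable x : F.

Let detB_neq0 : \det B != 0.
Proof.
by apply: contraNneq detB => e; rewrite det_map_mx e rmorph0.
Qed.

Lemma diag_sub_scalar (c : {poly F}) n (d : 'rV[{poly F}]_n) :
  diag_mx d - c%:M = diag_mx (\row_i (d 0 i - c)).
Proof. by apply/matrixP => i j; rewrite !mxE mulrnBl. Qed.

Lemma eig_rel_sub c : B *m (M - c%:M) =
  diag_mx (\row_i ((if P i then a else b) - c)) *m B.
Proof.
rewrite mulmxBr eig_rel mul_mx_scalar -mul_scalar_mx -mulmxBl diag_sub_scalar.
by congr (diag_mx _ *m _); apply/rowP => i; rewrite !mxE.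
Qed.

Lemma mxrank_specialize_sub c :
  (\rank (spec x M - (c.[x])%:M)%R <= #|[pred i | ((if P i then a else b) != c)%R]|)%N.
Proof.
have -> : spec x M - c.[x]%:M = spec x (M - c%:M) by rewrite map_mxB map_scalar_mx.
apply: leq_trans (mxrank_specialize _ _) _.
pose phi m n := @map_mx _ _ (@tofrac {poly F}) m n.
have uB : phi N N B \in unitmx by rewrite unitmxE det_map_mx unitfE tofrac_eq0.
have -> : \rank (phi _ _ (M - c%:M)) = \rank (phi _ _ B *m phi _ _ (M - c%:M)).
  by rewrite (eqmxMfull _ (_ : row_full (phi _ _ B))) // row_full_unit.
rewrite -map_mxM eig_rel_sub map_mxM; apply: leq_trans (mxrankM_maxl _ _) _.
rewrite map_diag_mx; apply: leq_trans (mxrank_diag_le _) _.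
apply/subset_leq_card/subsetP => i; rewrite !inE !mxE tofrac_eq0.
by rewrite subr_eq0.
Qed.

(** The product kills the rows of [B], and the adjugate of [B] cancels [B] up to
    the nonzero factor [\det B]. *)
Lemma quadratic_specialize : (spec x M - a.[x]%:M) *m (spec x M - b.[x]%:M) = 0.
Proof.
have E c : spec x M - c.[x]%:M = spec x (M - c%:M) by rewrite map_mxB map_scalar_mx.
rewrite !E -map_mxM; suff -> : (M - a%:M) *m (M - b%:M) = 0 by rewrite map_mx0.
set X := _ *m _; have BX : B *m X = 0.
  rewrite mulmxA eig_rel_sub -mulmxA eig_rel_sub mulmxA mulmx_diag.
  rewrite (_ : \row_j _ = 0) ?linear0 ?mul0mx //.
  by apply/rowP => i; rewrite !mxE; case: (P i); rewrite subrr (mul0r, mulr0).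
have : \adj B *m (B *m X) = 0 by rewrite BX mulmx0.
rewrite mulmxA mul_adj_mx mul_scalar_mx => /matrixP dX.
apply/matrixP => i j; have := dX i j; rewrite !mxE => /eqP.
by rewrite mulf_eq0 (negPf detB_neq0) /= => /eqP.
Qed.

End Specialization.

(** * Transport through the vertices of the cube *)
Section Lines.
Variable p : nat.
Implicit Types (x y : point p) (i j : 'I_3) (l : line p).

Lemma passesP i x y :
  reflect (forall j, j != i -> y j = x j) (passes (line_through i x) y).
Proof.
rewrite /passes /line_through /=; apply: (iffP eqP) => [[] /ffunP e j|e].
  by rewrite eq_sym => /unlift_some[t -> _]; have := e t; rewrite !ffunE.
by congr pair; apply/ffunP => t; rewrite !ffunE e // eq_sym neq_lift.
Qed.

Lemma passes_line_through i x : passes (line_through i x) x.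
Proof. exact/passesP. Qed.

Lemma passesE l x : passes l x -> l = line_through l.1 x.
Proof. by move/eqP. Qed.

Definition point_on i (a : thick_index p) (n : 'I_p) : point p :=
  [ffun j => if unlift i j is Some t then a t else n].

Lemma line_through_point_on i a n : line_through i (point_on i a n) = (i, a).
Proof. by congr pair; apply/ffunP => t; rewrite !ffunE liftK. Qed.

Lemma count_line i x (s : seq (point p)) c : uniq s -> (c <= p)%N ->
  (forall y, passes (line_through i x) y -> (y \in s) = (y i < c)%N) ->
  count (passes (line_through i x)) s = c.
Proof.
move=> us lecp ms; set l := line_through i x.
rewrite -size_filter -(size_map (fun y => val (y i))) -[RHS](size_iota 0).
apply/perm_size/uniq_perm; last 1 first.
- move=> n; rewrite mem_iota /= add0n; apply/mapP/idP => [[y]|ltn].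
    by rewrite mem_filter => /andP[ly sy] ->; rewrite -ms.
  pose y := point_on i l.2 (Ordinal (leq_trans ltn lecp)).
  have ly : passes l y.
    by have := passes_line_through i y; rewrite /y line_through_point_on.
  have yi : y i = n :> nat by rewrite ffunE unlift_none.
  by exists y; rewrite ?yi // mem_filter ly ms // yi.
- rewrite map_inj_in_uniq ?filter_uniq // => y z.
  rewrite !mem_filter => /andP[/passesP ly _] /andP[/passesP lz _] /val_inj eyz.
  by apply/ffunP => j; have [->|nji] := eqVneq j i; rewrite // ly // lz.
- exact: iota_uniq.
Qed.

(** The coordinates of the [n]-th position on the line [(l, a)], with [n]
    unrestricted: polynomials are indexed by natural exponents. *)
Definition line_coord (l : 'I_3) (a : thick_index p) (n : nat) (m : 'I_3) : nat :=
  if unlift l m is Some t then a t else n.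

Lemma line_coord_self (l : 'I_3) a n : line_coord l a n l = n.
Proof. by rewrite /line_coord unlift_none. Qed.

Lemma line_coord_other (l : 'I_3) a n m : (l == m) = false -> line_coord l a n m = line_coord l a 0 m.
Proof. by rewrite /line_coord; case: unliftP => // ->; rewrite eqxx. Qed.

Lemma line_coord_through (x : point p) (l : 'I_3) m :
  line_coord l [ffun t => x (lift l t)] (x l) m = x m.
Proof. by rewrite /line_coord; case: unliftP => [t ->|->]; rewrite ?ffunE. Qed.

End Lines.

Section Transport.
Variables (K : comNzRingType) (p : nat) (A : 'M[K]_3).
Implicit Types (x y : point p) (i j : 'I_3) (l m : line p).

(** [local_op] with entries in a commutative ring, so that it applies to
    matrices of polynomials. *)
Definition vertex_mx x : 'M[K]_#|line p| :=
  \matrix_(a, b)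
    let l := enum_val a in let m := enum_val b in
    if passes l x && passes m x then A l.1 m.1 else (l == m)%:R.

Definition row_of (r : line p -> K) : 'rV[K]_#|line p| := \row_a r (enum_val a).

Lemma vertex_step x r : row_of r *m vertex_mx x =
  row_of (fun m => if passes m x then \sum_i r (line_through i x) * A i m.1
                   else r m).
Proof.
apply/rowP => b; rewrite !mxE; set m := enum_val b.
under eq_bigr do rewrite !mxE.
rewrite -(big_enum_val (fun l => r l *
  (if passes l x && passes m x then A l.1 m.1 else (l == m)%:R))) /=.
have [mx|mx] := boolP (passes m x); last first.
  rewrite (bigD1 m) //= (negPf mx) andbF eqxx mulr1 big1 ?addr0 // => l nlm.
  by rewrite andbF (negPf nlm) mulr0.
rewrite (bigID (fun l => passes l x)) /= [X in _ + X]big1 ?addr0; last first.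
  move=> l nlx; rewrite (negPf nlx) /=; case: eqP => [elm|_]; last by rewrite mulr0.
  by move: nlx; rewrite elm mx.
rewrite (reindex_onto (fun i => line_through i x) fst) /=; last first.
  by move=> l /passesE <-.
apply: eq_big => [i|i _]; first by rewrite passes_line_through eqxx.
by rewrite passes_line_through.
Qed.

Definition block_prod (s : seq (point p)) : 'M[K]_#|line p| :=
  \big[mulmx/1%:M]_(x <- s) vertex_mx x.

(** The amplitude [w l n] is carried by the line [l] after [n] of its vertices.
    When the factor of a vertex x acts, a compatible order guarantees that
    exactly [x i] vertices have been passed on the i-th line through x, so the
    local relation at x is the action of that factor. *)
Lemma block_transport s (w : line p -> nat -> K) : compatible_order s ->
  (forall x i, w (line_through i x) (x i).+1 =
               \sum_j w (line_through j x) (x j) * A j i) ->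
  row_of (w^~ 0%N) *m block_prod s = row_of (w^~ p).
Proof.
move=> [perm_s ord_s] step.
have us : uniq s by rewrite (perm_uniq perm_s) enum_uniq.
have all_s y : y \in s by rewrite (perm_mem perm_s) mem_enum.
(* [s1] is the part of the product already applied: the line [l] has crossed as
   many vertices as it meets points of [s1]. *)
have tail s1 s2 : s = s1 ++ s2 ->
    row_of (fun l => w l (count (passes l) s1)) *m block_prod s2 = row_of (w^~ p).
  elim: s2 s1 => [|x s2 IH] s1 def_s.
    rewrite /block_prod big_nil mulmx1.
    apply/rowP => b; rewrite !mxE; case: (enum_val b) => i a.
    have [n _] : exists n : 'I_p, True by exists (a ord0).
    rewrite -(line_through_point_on i a n) (@count_line _ _ _ _ p) //.
      by rewrite cats0 in def_s; rewrite -def_s.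
    by move=> y _; rewrite ltn_ord; move: (all_s y); rewrite def_s cats0.
  have u1 : uniq s1 by move: us; rewrite def_s cat_uniq => /and3P[].
  have xs1 : x \notin s1.
    move: us; rewrite def_s cat_uniq /= negb_or => /and3P[_ /andP[] //].
  have cnt i : count (passes (line_through i x)) s1 = x i.
    apply: count_line => //; first exact/ltnW.
    move=> y /passesP exy.
    have [lt|le] := ltnP (y i) (x i).
      have : (index y s < index x s)%N.
        apply: ord_s => [|j]; first by apply: contraTneq lt => ->; rewrite ltnn.
        by have [->|nji] := eqVneq j i; [apply: ltnW|rewrite exy].
      rewrite def_s !index_cat (negPf xs1) /= eqxx addn0.
      by case: (y \in s1) => //; rewrite ltnNge leq_addr.
    have [->|nyx] := eqVneq y x; first exact: negPf.
    have : (index x s < index y s)%N.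
      apply: ord_s => [|j]; first by rewrite eq_sym.
      by have [->|nji] := eqVneq j i; rewrite // exy.
    rewrite def_s !index_cat (negPf xs1) /= eqxx addn0.
    by case: (boolP (y \in s1)) => //; rewrite -index_mem ltnNge; case: ltngtP => // *; lia.
  rewrite /block_prod big_cons mulmxA vertex_step -/(block_prod s2).
  rewrite -(IH (rcons s1 x)) ?cat_rcons //; congr (_ *m _).
  apply/rowP => b; rewrite !mxE; set m := enum_val b.
  rewrite -cats1 count_cat /= addn0; case: ifP => [mx|_]; last by rewrite addn0.
  under eq_bigr do rewrite cnt.
  by rewrite -step addn1 {2}(passesE mx) [in RHS](passesE mx) cnt.
have := tail [::] s erefl; congr (_ = _); congr (_ *m _).
Qed.

End Transport.

(** * Cofactors of 1 - A U *)
Section Cofactors.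
Variable T : comNzRingType.
Implicit Types (A : 'M[T]_3) (i j k : 'I_3) (u v : T).

(** With N = adj (1 - A U) and [i, j, k] the three axes, [off_cof A i j k u_k] is
    N_ij / u_j. *)
Definition off_cof A i j k u := A i j - (A i j * A k k - A i k * A k j) * u.
(** The diagonal cofactor N_ii, a polynomial in u_j and u_k. *)
Definition diag_cof A j k u v := (1 - A j j * u) * (1 - A k k * v) - A j k * A k j * (u * v).
(** Minus the coefficient of u_j in det (1 - A U), which is affine in u_j; its
    constant term is N_jj. *)
Definition det_slope A i j k u v :=
  A j j - (A i i * A j j - A i j * A j i) * u - (A j j * A k k - A j k * A k j) * v
  + (A i i * (A j j * A k k - A j k * A k j) - A i j * (A j i * A k k - A j k * A k i)
     + A i k * (A j i * A k j - A j j * A k i)) * (u * v).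
Definition char_det A i j k ui uj uk := diag_cof A k i uk ui - det_slope A i j k ui uk * uj.

(** A monomial in the entries N_ii, N_ij, N_ik of row i; [u] and [v] stand for
    u_j and u_k. *)
Definition row_monomial A i j k u v a b c :=
  diag_cof A j k u v ^+ a * (u * off_cof A i j k v) ^+ b * (v * off_cof A i k j u) ^+ c.
(** The column analogue.  The entries of column i of adj (1 - U A), which are
    those of column i of N up to ratios of variables, form row i of
    adj (1 - A^T U).  The two additional factors are s_ki and s_ji; they supply
    what is missing from a monomial of degree p - 2 for a p-th power of s_ji to
    come out in each step. *)
Definition col_monomial A i j k u v a b c :=
  off_cof A k i j u * off_cof A j i k v * row_monomial A^T i j k u v a b c.

(** Together with the next two identities: N (1 - A U) = D, on row i. *)
Lemma cofactor_row_i A i j k ui uj uk :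
  diag_cof A j k uj uk - ui * (diag_cof A j k uj uk * A i i + uj * off_cof A i j k uk * A j i
     + uk * off_cof A i k j uj * A k i) = char_det A i j k ui uj uk.
Proof. by rewrite /char_det /diag_cof /off_cof /det_slope; ring. Qed.

Lemma cofactor_row_j A i j k uj uk :
  diag_cof A j k uj uk * A i j + uj * off_cof A i j k uk * A j j
     + uk * off_cof A i k j uj * A k j = off_cof A i j k uk.
Proof. by rewrite /diag_cof /off_cof; ring. Qed.

Lemma cofactor_row_k A i j k uj uk :
  diag_cof A j k uj uk * A i k + uj * off_cof A i j k uk * A j k
     + uk * off_cof A i k j uj * A k k = off_cof A i k j uj.
Proof. by rewrite /diag_cof /off_cof; ring. Qed.

(** Put u_j = al / be with D = al - be u_j, multiply by be, and N_ii becomes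
    s_ij N_ji.  This is the vanishing on D = 0 of the minor
    N_ii N_jj - N_ij N_ji of N, whose factor N_jj is al. *)
Lemma subst_diag_cof A i j k u v :
  (1 - A k k * v) * det_slope A i j k u v
  - (A j j * (1 - A k k * v) + A j k * A k j * v) * diag_cof A k i v u
  = off_cof A i j k v * (u * off_cof A j i k v).
Proof. by rewrite /diag_cof /off_cof /det_slope; ring. Qed.

(** The same for N_ik, which becomes s_ij N_jk.  For N_ij = u_j s_ij it
    is clear: u_j becomes al = N_jj. *)
Lemma subst_third_cof A i j k u v :
  v * A i k * det_slope A i j k u v - v * (A i k * A j j - A i j * A j k) * diag_cof A k i v u
  = off_cof A i j k v * (v * off_cof A j k i u).
Proof. by rewrite /diag_cof /off_cof /det_slope; ring. Qed.

(** The same substitution in the factor s_ki of [col_monomial]: it becomes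
    s_ji s_kj. *)
Lemma subst_col_factor A i j k u v :
  A k i * det_slope A i j k u v - (A k i * A j j - A k j * A j i) * diag_cof A k i v u
  = off_cof A j i k v * off_cof A k j i u.
Proof. by rewrite /diag_cof /off_cof /det_slope; ring. Qed.

Lemma off_cof_tr A i j k u : off_cof A^T i j k u = off_cof A j i k u.
Proof. by rewrite /off_cof !mxE; ring. Qed.
Lemma diag_cof_tr A j k u v : diag_cof A^T j k u v = diag_cof A j k u v.
Proof. by rewrite /diag_cof !mxE; ring. Qed.
Lemma det_slope_tr A i j k u v : det_slope A^T i j k u v = det_slope A i j k u v.
Proof. by rewrite /det_slope !mxE; ring. Qed.
End Cofactors.

Section Morph.
Variables (T S : comNzRingType) (phi : {rmorphism T -> S}).
Lemma map_off_cof A i j k u : phi (off_cof A i j k u) = off_cof (map_mx phi A) i j k (phi u).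
Proof. by rewrite /off_cof !mxE; do 4!rewrite ?rmorphB ?rmorphM /=. Qed.
Lemma map_diag_cof A j k u v : phi (diag_cof A j k u v) = diag_cof (map_mx phi A) j k (phi u) (phi v).
Proof. by rewrite /diag_cof !mxE; do 5!rewrite ?rmorphB ?rmorphM ?rmorph1 /=. Qed.
Lemma map_det_slope A i j k u v :
  phi (det_slope A i j k u v) = det_slope (map_mx phi A) i j k (phi u) (phi v).
Proof. by rewrite /det_slope !mxE; do 7!rewrite ?rmorphN ?rmorphD ?rmorphM /=. Qed.
Lemma map_row_monomial A i j k u v a b c :
  phi (row_monomial A i j k u v a b c) = row_monomial (map_mx phi A) i j k (phi u) (phi v) a b c.
Proof.
rewrite /row_monomial; do 4!rewrite ?rmorphM ?rmorphXn /=.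
by rewrite !map_off_cof map_diag_cof.
Qed.
Lemma map_col_monomial A i j k u v a b c :
  phi (col_monomial A i j k u v a b c) = col_monomial (map_mx phi A) i j k (phi u) (phi v) a b c.
Proof. by rewrite /col_monomial 2!rmorphM /= !map_off_cof map_row_monomial map_trmx. Qed.
End Morph.

(** * Elimination of a variable in characteristic p *)
Section Homogenization.
Variables (T : idomainType) (al be : T).

(** This is be^n q (al / be) for [q] of degree at most [n]. *)
Definition homog n (q : {poly T}) := \sum_(a < n.+1) q`_a * (al ^+ a * be ^+ (n - a)).

Definition affine (x : T * T) : {poly T} := x.1%:P + x.2%:P * 'X.

Lemma size_prod_affine (rs : seq (T * T)) :
  (size (\prod_(x <- rs) affine x)%R <= (size rs).+1)%N.
Proof.
elim: rs => [|x rs IH] /=; first by rewrite big_nil size_poly1.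
rewrite big_cons; apply: leq_trans (size_polyMleq _ _) _.
have : (size (affine x) <= 2)%N.
  apply: leq_trans (size_polyD _ _) _; rewrite geq_max.
  rewrite (leq_trans (size_polyC_leq1 _)) //=.
  by apply: leq_trans (size_polyMleq _ _) _; rewrite size_polyX addn2 /= ltnS size_polyC_leq1.
by move=> s2; rewrite -subn1 leq_subLR; apply: leq_trans (leq_add s2 IH) _.
Qed.

Lemma homog_affine n x (q : {poly T}) : (size q <= n.+1)%N ->
  homog n.+1 (affine x * q) = (x.1 * be + x.2 * al) * homog n q.
Proof.
move=> sq; rewrite /homog [RHS]mulrDl; set r := affine x * q.
have E a : r`_a = x.1 * q`_a + x.2 * (if a is a'.+1 then q`_a' else 0).
  rewrite /r mulrDl coefD coefCM -mulrA coefCM coefXM.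
  by case: a.
under eq_bigr do rewrite E mulrDl; rewrite big_split /=; congr (_ + _).
  rewrite big_ord_recr /= (nth_default 0 sq) mulr0 mul0r addr0 mulr_sumr.
  apply: eq_bigr => a _; rewrite subSn; last by rewrite -ltnS.
  by rewrite exprS; move: (be ^+ _) (al ^+ _) => y z; ring.
rewrite big_ord_recl /= mulr0 mul0r add0r mulr_sumr.
apply: eq_bigr => a _; rewrite /bump /= add1n subSS exprS.
by move: (be ^+ _) (al ^+ _) => y z; ring.
Qed.

Lemma homog_prod (rs : seq (T * T)) :
  homog (size rs) (\prod_(x <- rs) affine x) = \prod_(x <- rs) (x.1 * be + x.2 * al).
Proof.
elim: rs => [|x rs IH] /=.
  by rewrite !big_nil /homog big_ord1 coef1 !mul1r.
by rewrite !big_cons homog_affine ?size_prod_affine // IH.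
Qed.

Variable p : nat.
Hypothesis hp : p \in [pchar T].

(** In characteristic p the binomial coefficients of p - 1 alternate in sign:
    divide (x - y)^p = x^p - y^p by x - y. *)
Lemma exprB_pchar_pred (x y : T) :
  (x - y) ^+ p.-1 = \sum_(i < p) x ^+ (p.-1 - i) * y ^+ i.
Proof.
have p_gt0 : (0 < p)%N := prime_gt0 (pcharf_prime hp).
have [->|nxy] := eqVneq x y.
  have p_gt1 := prime_gt1 (pcharf_prime hp).
  rewrite subrr expr0n (_ : (p.-1 == 0)%N = false) /=; last by lia.
  rewrite (eq_bigr (fun=> y ^+ p.-1)) => [|i _]; last first.
    by rewrite -exprD subnK // -ltnS prednK.
  by rewrite sumr_const card_ord -[RHS]mulr_natr (pcharf0 hp) mulr0.
apply: (mulfI (_ : x - y != 0)); first by rewrite subr_eq0.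
rewrite -exprS prednK // -[LHS](pFrobenius_autE hp) pFrobenius_autB_comm; last exact: mulrC.
by rewrite !pFrobenius_autE subrXX.
Qed.
End Homogenization.

Section Residue.
Variables (T : idomainType) (p : nat) (al be : T).
Hypothesis hp : p \in [pchar T].

Lemma coef_affine_expr k : (k < p)%N ->
  ((al%:P - be%:P * 'X) ^+ p.-1)`_k = al ^+ (p.-1 - k) * be ^+ k.
Proof.
move=> ltkp; have hpP : p \in [pchar {poly T}] by rewrite pchar_poly.
rewrite (exprB_pchar_pred hpP) coef_sum (bigD1 (Ordinal ltkp)) //= big1 => [|i nik].
  by rewrite exprMn -!polyC_exp mulrA -polyCM coefCM coefXn eqxx mulr1 addr0.
rewrite exprMn -!polyC_exp mulrA -polyCM coefCM coefXn.
by case: eqP => [e|_]; rewrite ?mulr0 //; case/eqP: nik; apply: val_inj.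
Qed.

(** The coefficients of (al - be u)^(p-1) are the weights al^a be^(p-1-a) that
    substitute al / be for the variable. *)
Lemma coef_homog (q : {poly T}) :
  (q * (al%:P - be%:P * 'X) ^+ p.-1)`_p.-1 = homog al be p.-1 q.
Proof.
have p_gt0 : (0 < p)%N := prime_gt0 (pcharf_prime hp).
rewrite coefM /homog; apply: eq_bigr => a _.
have le_a : (a <= p.-1)%N by rewrite -ltnS.
by rewrite coef_affine_expr ?subKn //; apply: leq_ltn_trans (leq_subr _ _) _; rewrite prednK.
Qed.
End Residue.

(** * The blocks R_ij as elimination of a variable *)
Section Step.
Variables (K : idomainType) (p : nat) (A : 'M[K]_3).
Hypothesis hp : p \in [pchar K].
Variables (i j k : 'I_3).
Hypothesis ijk : uniq [:: i; j; k].

Let p_gt0 : (0 < p)%N. Proof. exact: prime_gt0 (pcharf_prime hp). Qed.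

Lemma axes_case (l : 'I_3) : [\/ l = i, l = j | l = k].
Proof.
have [_] := uniq_min_size ijk (fun l _ => mem_enum 'I_3 l) (eq_leq (size_enum_ord 3)).
by move/(_ l); rewrite mem_enum !inE => /or3P[]/eqP->; [constructor 1|constructor 2|constructor 3].
Qed.

Lemma axes_sum (R : nmodType) (f : 'I_3 -> R) : \sum_l f l = f i + f j + f k.
Proof.
have pl : perm_eq [:: i; j; k] (index_enum 'I_3).
  apply: uniq_perm => //; first exact: index_enum_uniq.
  by move=> l; rewrite mem_index_enum !inE; case: (axes_case l) => ->; rewrite eqxx ?orbT.
by rewrite -(perm_big _ pl) /= !big_cons big_nil addr0 addrA.
Qed.

Local Notation P2 := {poly {poly K}}.
Local Notation P3 := {poly {poly {poly K}}}.

(* Polynomials in the three variables are nested with u_j outermost, then u_i,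
   then u_k, the order in which the elimination of u_j needs them. *)
Let ui : P2 := 'X.
Let uk : P2 := 'X%:P.
Let A2 : 'M[P2]_3 := map_mx polyC (map_mx polyC A).
Let A3 : 'M[P3]_3 := map_mx polyC A2.

Let U (l : 'I_3) : P3 := if l == i then ui%:P else if l == j then 'X else uk%:P.

Let nij : (i == j) = false. Proof. by apply/negP => /eqP e; move: ijk; rewrite e /= inE eqxx. Qed.
Let nik : (i == k) = false. Proof. by apply/negP => /eqP e; move: ijk; rewrite e /= !inE eqxx orbT. Qed.
Let njk : (j == k) = false.
Proof. by apply/negP => /eqP e; move: ijk; rewrite e /= !inE eqxx andbF. Qed.
Let neqs := (nij, nik, njk, (eq_sym j i), (eq_sym k i), (eq_sym k j), eqxx).

Lemma UE : (U i = ui%:P) * (U j = 'X) * (U k = uk%:P).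
Proof. by rewrite /U !neqs. Qed.

Definition coef3 (q : P3) (e : 'I_3 -> nat) : K := q`_(e j)`_(e i)`_(e k).

Lemma coef3D q r e : coef3 (q + r) e = coef3 q e + coef3 r e.
Proof. by rewrite /coef3 !coefD. Qed.

Lemma coef30 e : coef3 0 e = 0. Proof. by rewrite /coef3 !coef0. Qed.

Lemma coef3_cst q l m e : coef3 (q * A3 l m) e = coef3 q e * A l m.
Proof. by rewrite /coef3 !mxE !coefMC. Qed.

Lemma eq_coef3 q e e' : e =1 e' -> coef3 q e = coef3 q e'.
Proof. by move=> ee'; rewrite /coef3 !ee'. Qed.

Definition upd (e : 'I_3 -> nat) l n m := if m == l then n else e m.

Lemma coef3_U l q e :
  coef3 (U l * q) e = if e l is n.+1 then coef3 q (upd e l n) else 0.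
Proof.
rewrite /coef3 /upd; case: (axes_case l) => ->; rewrite UE !neqs.
- by rewrite coefCM coefXM; case: (e i) => //=; rewrite coef0.
- by rewrite coefXM; case: (e j) => //=; rewrite !coef0.
- by rewrite coefCM coefCM coefXM; case: (e k).
Qed.

Lemma coef3_Uexp l n q e : (e l < n)%N -> coef3 (U l ^+ n * q) e = 0.
Proof.
elim: n e => // n IH e lt; rewrite exprS -mulrA coef3_U.
by case: (e l) lt => // m lt; rewrite IH // /upd eqxx.
Qed.

Let al : P2 := diag_cof A2 k i uk ui.
Let be : P2 := det_slope A2 i j k ui uk.
Let D : P3 := char_det A3 i j k (U i) (U j) (U k).

Lemma DE : D = al%:P - be%:P * 'X.
Proof. by rewrite /D /char_det !UE map_diag_cof map_det_slope. Qed.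

Let hp3 : p \in [pchar P3]. Proof. by rewrite !pchar_poly. Qed.

(** By Frobenius D^p is 1 plus multiples of the u_l^p, which do not contribute to
    exponents inside the cube. *)
Lemma coef3_Dp q e : (forall l, (e l < p)%N) -> coef3 (q * D ^+ p) e = coef3 q e.
Proof.
move=> lt.
have [X [Y [Z ->]]] : exists X Y Z, D = 1 + U i * X + U j * Y + U k * Z.
  exists (- (A3 i i * (1 - A3 k k * U k) + A3 k i * A3 i k * U k)),
    (- det_slope A3 i j k (U i) (U k)), (- A3 k k).
  by rewrite /D /char_det /diag_cof; ring.
rewrite -(pFrobenius_autE hp3) !rmorphD rmorph1 !rmorphM /= !pFrobenius_autE.
rewrite !mulrDr mulr1 !(mulrCA q) !coef3D.
by rewrite !coef3_Uexp // !addr0.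
Qed.

Variable f : P2.
Let ff : P3 := map_poly polyC f.

Lemma coef3_ff e : coef3 ff e = if e i == 0 then f`_(e j)`_(e k) else 0.
Proof. by rewrite /coef3 coef_map /= coefC; case: ifP; rewrite ?coef0. Qed.

(* The generating functions of the amplitudes entering the vertices along each
   axis ([V]) and leaving them ([Out]), when [f] is fed into direction [i]. *)
Let V l : P3 := ff * D ^+ p.-1 *
  (if l == i then diag_cof A3 j k (U j) (U k) else
   if l == j then U j * off_cof A3 i j k (U k) else U k * off_cof A3 i k j (U j)).

Let Out l : P3 := \sum_m V m * A3 m l.

Lemma Out_j : Out j = ff * D ^+ p.-1 * off_cof A3 i j k (U k).
Proof.
rewrite /Out axes_sum /V !neqs -[in RHS](cofactor_row_j A3 i j k (U j) (U k)).
by move: (_ ^+ _) => ?; ring.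
Qed.

(** The functional equation of the amplitudes: what enters a vertex has left the
    preceding one or is the input.  The input is multiplied by D^p because [V] is
    f N_i / D multiplied by D^p. *)
Lemma V_rec l : V l = U l * Out l + (if l == i then ff * D ^+ p else 0).
Proof.
rewrite /Out axes_sum; case: (axes_case l) => ->; rewrite /V !neqs.
- have -> : D ^+ p = D ^+ p.-1 * D by rewrite -exprSr prednK.
  by move: (D ^+ p.-1) => G; rewrite /D -cofactor_row_i; ring.
- rewrite -[in LHS](cofactor_row_j A3 i j k (U j) (U k)).
  by move: (_ ^+ _) => ?; ring.
- rewrite -[in LHS](cofactor_row_k A3 i j k (U j) (U k)).
  by move: (_ ^+ _) => ?; ring.
Qed.

(** Positions other than the initial one are described as outputs of the preceding
    vertex, so that the final position [p] is covered as well. *)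
Definition amplitude (l : line p) (n : nat) : K :=
  if n is n'.+1 then coef3 (Out l.1) (line_coord l.1 l.2 n')
  else if l.1 == i then f`_(line_coord i l.2 0 j)`_(line_coord i l.2 0 k) else 0.

Lemma amplitude_V (x : point p) l : amplitude (line_through l x) (x l) = coef3 (V l) (fun m => x m).
Proof.
have ltx m : (x m < p)%N by [].
rewrite V_rec coef3D coef3_U /amplitude /=; case E: (x l : nat) => [|n].
  rewrite add0r; case: eqP => [eli|_]; last by rewrite coef30.
  rewrite coef3_Dp // coef3_ff -eli E eqxx.
  by have cx := line_coord_through x l; rewrite E in cx; rewrite !cx.
have -> : coef3 (if l == i then ff * D ^+ p else 0) (fun m => x m) = 0.
  by case: eqP => [eli|_]; rewrite ?coef30 // coef3_Dp // coef3_ff -eli E.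
rewrite addr0; apply: eq_coef3 => m; rewrite /line_coord /upd /=.
by case: unliftP => [t ->|->]; rewrite ?eqxx // eq_sym (negPf (neq_lift _ _)) ffunE.
Qed.

Lemma amplitude_step (x : point p) l :
  amplitude (line_through l x) (x l).+1 = \sum_m amplitude (line_through m x) (x m) * A m l.
Proof.
under eq_bigr do rewrite amplitude_V -coef3_cst.
rewrite /amplitude /= (@eq_coef3 _ _ (fun m => x m)); last exact: line_coord_through.
by rewrite /Out; elim/big_rec2: _ => [|m a b _ <-]; rewrite ?coef30 ?coef3D.
Qed.

Lemma amplitude_end a :
  amplitude (j, a) p =
    (off_cof A2 i j k uk * homog al be p.-1 ff)`_(line_coord j a 0 i)`_(line_coord j a 0 k).
Proof.
have hp2 : p \in [pchar P2] by rewrite !pchar_poly.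
have gt0 n : (0 < n)%N -> amplitude (j, a) n = coef3 (Out j) (line_coord j a n.-1) by case: n.
rewrite gt0 // Out_j mulrAC /coef3 line_coord_self !(line_coord_other _ p.-1) ?neqs // DE UE.
by rewrite -map_off_cof mulrAC coefMC coef_homog // mulrC.
Qed.

End Step.

(** [thick_block] over a commutative ring. *)
Definition thick_part (K : comNzRingType) (p : nat) (R : 'M[K]_#|line p|)
    (i j : 'I_3) : 'M[K]_#|thick_index p| :=
  \matrix_(a, b) R (enum_rank (i, enum_val a : thick_index p))
                   (enum_rank (j, enum_val b : thick_index p)).

(** The vector of the thick space of axis [i] encoded by [f], whose outer variable
    is u_j and inner variable u_k. *)
Definition thick_vec (K : comNzRingType) p (i j k : 'I_3) (f : {poly {poly K}}) :
    'rV[K]_#|thick_index p| :=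
  \row_a f`_(line_coord i (enum_val a) 0 j)`_(line_coord i (enum_val a) 0 k).

Section Step2.
Variables (K : idomainType) (p : nat) (A : 'M[K]_3).
Hypothesis hp : p \in [pchar K].
Variables (i j k : 'I_3).
Hypothesis ijk : uniq [:: i; j; k].
Local Notation P2 := {poly {poly K}}.
Let p_gt0 : (0 < p)%N. Proof. exact: prime_gt0 (pcharf_prime hp). Qed.
Let A2 : 'M[P2]_3 := map_mx polyC (map_mx polyC A).

(** The result is a polynomial in u_i (outer) and u_k (inner), while the axes of
    the next step, [j, k, i], require u_k outside: hence [swapXY]. *)
Lemma thick_step s (f : P2) : compatible_order s ->
  thick_vec p i j k f *m thick_part (block_prod A s) i j =
  thick_vec p j k i (swapXY (off_cof A2 i j k 'X%:P *
    homog (diag_cof A2 k i 'X%:P 'X) (det_slope A2 i j k 'X 'X%:P) p.-1 (map_poly polyC f))).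
Proof.
move=> cs; have hp2 : p \in [pchar P2] by rewrite !pchar_poly.
have := block_transport cs (amplitude_step A hp ijk f) => /rowP tr.
apply/rowP => b; have := tr (enum_rank (j, enum_val b : thick_index p)).
rewrite [RHS]mxE enum_rankK amplitude_end // => trb; rewrite [RHS]mxE coef_swapXY -{}trb.
rewrite !mxE; under [RHS]eq_bigr do rewrite mxE.
rewrite [RHS](reindex (@enum_rank (line p))) /=; last first.
  by apply: onW_bij; apply: enum_rank_bij.
under [RHS]eq_bigr do rewrite enum_rankK.
pose G m (a : thick_index p) : K := amplitude A i j k f (m, a) 0 *
  block_prod A s (enum_rank (m, a)) (enum_rank (j, enum_val b : thick_index p)).
rewrite (eq_bigr (fun l => G l.1 l.2)) => [|[] //]; rewrite -pair_bigA /=.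
rewrite (bigD1 i) //= [X in _ = _ + X]big1 ?addr0 => [|m nmi]; last first.
  by rewrite big1 // => a _; rewrite /G /amplitude (negPf nmi) mul0r.
rewrite [RHS](reindex (@enum_val (thick_index p) predT)) /=; last first.
  by apply: onW_bij; apply: enum_val_bij.
by apply: eq_bigr => a _; rewrite /G !mxE /amplitude eqxx.
Qed.
End Step2.

(** * Eigenvectors *)
Section Factors.
Variable T : comNzRingType.
Implicit Types (A : 'M[T]_3) (i j k : 'I_3) (u v : T).
(** Constant term and slope in u_j of N_ii, N_ij, N_ik and of the product
    s_ki s_ji; [v] is u_k. *)
Definition diag_factor A j k v : T * T :=
  (1 - A k k * v, - (A j j * (1 - A k k * v) + A j k * A k j * v)).
Definition self_factor A i j k v : T * T := (0, off_cof A i j k v).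
Definition third_factor A i j k v : T * T := (v * A i k, - (v * (A i k * A j j - A i j * A j k))).
Definition col_factor A i j k v : T * T :=
  (A k i * off_cof A j i k v, - (A k i * A j j - A k j * A j i) * off_cof A j i k v).
End Factors.

Definition cst2 (K : comNzRingType) (A : 'M[K]_3) : 'M[{poly {poly K}}]_3 :=
  map_mx polyC (map_mx polyC A).

Section Step3.
Variables (K : idomainType) (p : nat) (A : 'M[K]_3).
Hypothesis hp : p \in [pchar K].
Variables (i j k : 'I_3).
Hypothesis ijk : uniq [:: i; j; k].
Variable s : seq (point p).
Hypothesis cs : compatible_order s.
Local Notation P2 := {poly {poly K}}.
Let p_gt0 : (0 < p)%N. Proof. exact: prime_gt0 (pcharf_prime hp). Qed.
Let A2 := cst2 A.
Let A3 := map_mx polyC A2.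
Let uk : P2 := 'X%:P.
Let ui : P2 := 'X.
Let al : P2 := diag_cof A2 k i uk ui.
Let be : P2 := det_slope A2 i j k ui uk.

Lemma step_prod (f : P2) (rs : seq (P2 * P2)) : size rs = p.-1 ->
  map_poly polyC f = \prod_(x <- rs) affine x ->
  thick_vec p i j k f *m thick_part (block_prod A s) i j =
  thick_vec p j k i (swapXY (off_cof A2 i j k uk * \prod_(x <- rs) (x.1 * be + x.2 * al))).
Proof. by move=> sz ef; rewrite (thick_step A hp ijk) // ef -sz homog_prod. Qed.

(** By Frobenius the p-th power of [off_cof A l m n u_k] is A_lm^p plus a multiple
    of u_k^p, and [thick_vec] ignores exponents from p on. *)
Lemma thick_vec_mod l m n g :
  thick_vec p j k i (swapXY (off_cof A2 l m n uk ^+ p * g)) =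
  A l m ^+ p *: thick_vec p j k i (swapXY g).
Proof.
have hp1 : p \in [pchar {poly K}] by rewrite pchar_poly.
rewrite /A2 /uk -map_off_cof -rmorphXn /=; apply/rowP => b; rewrite !mxE !coef_swapXY.
rewrite coefCM /off_cof -(pFrobenius_autE hp1) rmorphB rmorphM /= !pFrobenius_autE.
rewrite mulrBl coefB -mulrA mulrCA coefXnM mxE -rmorphXn coefCM.
suff -> : (line_coord j (enum_val b) 0 k < p)%N by rewrite subr0.
by rewrite /line_coord; case: unlift.
Qed.

Lemma map_cst2_swap : map_mx swapXY A2 = A2.
Proof. by apply/matrixP => x y; rewrite !mxE swapXY_polyC map_polyC. Qed.

Lemma map_cst2_emb : map_mx (map_poly polyC) A2 = A3.
Proof. by apply/matrixP => x y; rewrite !mxE map_polyC. Qed.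

Lemma diag_factorE (B : 'M[P2]_3) :
  diag_cof (map_mx polyC B) j k 'X uk%:P =
  affine (diag_factor B j k uk).
Proof. by rewrite /affine /diag_cof /diag_factor !mxE /=; move: (uk) => v; ring. Qed.
Lemma self_factorE (B : 'M[P2]_3) :
  'X * off_cof (map_mx polyC B) i j k uk%:P =
  affine (self_factor B i j k uk).
Proof. by rewrite /affine /self_factor /off_cof !mxE /=; move: (uk) => v; ring. Qed.

Lemma third_factorE (B : 'M[P2]_3) :
  uk%:P * off_cof (map_mx polyC B) i k j 'X =
  affine (third_factor B i j k uk).
Proof. by rewrite /affine /third_factor /off_cof !mxE /=; move: (uk) => v; ring. Qed.

Lemma col_factorE (B : 'M[P2]_3) :
  off_cof (map_mx polyC B) k i j 'X * off_cof (map_mx polyC B) j i k uk%:P =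
  affine (col_factor B i j k uk).
Proof. by rewrite /affine /col_factor /off_cof !mxE /=; move: (uk) => v; ring. Qed.

Let swap : {rmorphism P2 -> P2} := swapXY.

Lemma swap_row_monomial l m n a b c :
  swapXY (row_monomial A2 l m n uk ui a b c) = row_monomial A2 l m n ui uk a b c.
Proof.
have := map_row_monomial swap A2 l m n uk ui a b c; rewrite map_cst2_swap => e.
by apply: etrans e _; congr row_monomial; [apply: swapXY_Y|apply: swapXY_X].
Qed.

Lemma swap_col_monomial l m n a b c :
  swapXY (col_monomial A2 l m n uk ui a b c) = col_monomial A2 l m n ui uk a b c.
Proof.
have := map_col_monomial swap A2 l m n uk ui a b c; rewrite map_cst2_swap => e.
by apply: etrans e _; congr col_monomial; [apply: swapXY_Y|apply: swapXY_X].
Qed.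

Definition row_factors (B : 'M[P2]_3) a b c :=
  nseq a (diag_factor B j k uk) ++ nseq b (self_factor B i j k uk)
  ++ nseq c (third_factor B i j k uk).

Lemma size_row_factors B a b c : size (row_factors B a b c) = (a + b + c)%N.
Proof. by rewrite !size_cat !size_nseq addnA. Qed.

Lemma prod_row_factors (R : comNzRingType) (h : P2 * P2 -> R) B a b c :
  \prod_(x <- row_factors B a b c) h x =
  h (diag_factor B j k uk) ^+ a * h (self_factor B i j k uk) ^+ b *
  h (third_factor B i j k uk) ^+ c.
Proof. by rewrite !big_cat !big_nseq !iter_mulr_1 /= mulrA. Qed.

Lemma subst_row_factors B a b c :
  \prod_(x <- row_factors B a b c)
    (x.1 * det_slope B i j k ui uk + x.2 * diag_cof B k i uk ui) =
  off_cof B i j k uk ^+ (a + b + c) * row_monomial B j k i uk ui b c a.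
Proof.
rewrite prod_row_factors /diag_factor /self_factor /third_factor /= !mulNr.
rewrite subst_diag_cof subst_third_cof mul0r add0r.
by rewrite /row_monomial !exprMn !exprD; ring.
Qed.

Lemma embed_row_monomial (B : 'M[P2]_3) a b c : map_mx (map_poly polyC) B = map_mx polyC B ->
  map_poly polyC (row_monomial B i j k ui uk a b c) = \prod_(x <- row_factors B a b c) affine x.
Proof.
move=> eB; rewrite map_row_monomial eB /= /ui /uk map_polyX map_polyC prod_row_factors /row_monomial.
by rewrite diag_factorE self_factorE third_factorE.
Qed.

(** The p - 1 factors of the monomial and the factor of [thick_step] each
    contribute s_ij, whence its p-th power. *)
Lemma row_monomial_step a b c : (a + b + c)%N = p.-1 ->
  thick_vec p i j k (row_monomial A2 i j k 'X 'X%:P a b c) *m thick_part (block_prod A s) i j =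
  A i j ^+ p *: thick_vec p j k i (row_monomial A2 j k i 'X 'X%:P b c a).
Proof.
move=> abc; rewrite (@step_prod _ (row_factors A2 a b c)) ?size_row_factors //; last first.
  exact: embed_row_monomial map_cst2_emb.
rewrite -/ui -/uk -swap_row_monomial -(thick_vec_mod i j k); congr (thick_vec _ _ _ _ (swapXY _)).
have := subst_row_factors A2 a b c; rewrite -/al -/be => ->.
by rewrite abc mulrA -exprS prednK.
Qed.

(** The p - 2 factors of the monomial contribute s_ji each, and the substitution in
    s_ki s_ji gives s_ji^2 s_kj.  This makes s_ji^p, and the remaining s_kj and
    the s_ij of [thick_step] are the two factors of [col_monomial] at j. *)
Lemma col_monomial_step a b c : (a + b + c).+1 = p.-1 ->
  thick_vec p i j k (col_monomial A2 i j k 'X 'X%:P a b c) *m thick_part (block_prod A s) i j =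
  A j i ^+ p *: thick_vec p j k i (col_monomial A2 j k i 'X 'X%:P b c a).
Proof.
move=> abc.
rewrite (@step_prod _ (col_factor A2 i j k uk :: row_factors A2^T a b c)); last 2 first.
- by rewrite /= size_row_factors.
- rewrite /col_monomial rmorphM /= big_cons embed_row_monomial; last first.
    by rewrite -!map_trmx map_cst2_emb.
  pose emb : {rmorphism P2 -> {poly P2}} := map_poly polyC.
  have e1 := map_off_cof emb A2 k i j ui; have e2 := map_off_cof emb A2 j i k uk.
  rewrite map_cst2_emb in e1 e2; rewrite -col_factorE rmorphM; congr (_ * _ * _).
    by apply: etrans e1 _; congr off_cof; apply: map_polyX.
  by apply: etrans e2 _; congr off_cof; apply: map_polyC.
rewrite -/ui -/uk -swap_col_monomial -(thick_vec_mod j i k); congr (thick_vec _ _ _ _ (swapXY _)).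
have := subst_row_factors A2^T a b c; rewrite det_slope_tr diag_cof_tr off_cof_tr -/al -/be => prodE.
rewrite big_cons {}prodE /col_factor /= !mulNr.
have -> : A2 k i * off_cof A2 j i k uk * be -
      (A2 k i * A2 j j - A2 k j * A2 j i) * off_cof A2 j i k uk * al
    = off_cof A2 j i k uk * (off_cof A2 j i k uk * off_cof A2 k j i ui).
  by rewrite -subst_col_factor -/al -/be; ring.
rewrite -[in RHS](prednK p_gt0) -abc !exprS /col_monomial.
by move: (row_monomial _ _ _ _ _ _ _ _ _) (_ ^+ _) => x y; ring.
Qed.
End Step3.

Section Coordinates.
Variable p : nat.
Definition coord1 (a : thick_index p) : nat := line_coord 0 a 0 1.
Definition coord2 (a : thick_index p) : nat := line_coord 0 a 0 2.

Lemma coord1E a : coord1 a = a 0.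
Proof. by rewrite /coord1 /line_coord (_ : 1 = lift 0 0 :> 'I_3) ?liftK //; apply: val_inj. Qed.
Lemma coord2E a : coord2 a = a 1.
Proof. by rewrite /coord2 /line_coord (_ : 2 = lift 0 1 :> 'I_3) ?liftK //; apply: val_inj. Qed.

Lemma coord_inj a b : coord1 a = coord1 b -> coord2 a = coord2 b -> a = b.
Proof.
rewrite !coord1E !coord2E => /val_inj ex /val_inj ey; apply/ffunP => t.
by case: (unliftP 0 t) => [u|] -> //; rewrite (_ : lift 0 u = 1) // ord1; apply: val_inj.
Qed.

Lemma card_above_diagonal : #|[pred a : thick_index p | (coord1 a < coord2 a)%N]| = 'C(p, 2).
Proof.
pose h (u : 'I_p * 'I_p) : thick_index p := [ffun t => if t == 0 then u.1 else u.2].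
have h_bij : bijective h.
  exists (fun a : thick_index p => (a 0, a 1)) => [[x y]|a]; first by rewrite !ffunE.
  by apply: coord_inj; rewrite !(coord1E, coord2E) ffunE.
rewrite -sum1_card big_mkcond (reindex h) /=; last exact: onW_bij.
rewrite -bin2_sum big_mkord.
rewrite (eq_bigr (fun u : 'I_p * 'I_p => nat_of_bool (u.1 < u.2)%N)); last first.
  by move=> u _; rewrite inE coord1E coord2E !ffunE /=; case: ltnP.
rewrite -(pair_bigA _ (fun x y : 'I_p => nat_of_bool (x < y)%N)) exchange_big /=.
apply: eq_bigr => y _.
rewrite -big_mkcond -(big_ord_widen p (fun=> 1%N)) ?sum1_card ?card_ord //.
exact: ltnW.
Qed.

Lemma card_below_diagonal :
  (#|[pred a : thick_index p | (coord2 a <= coord1 a)%N]| + 'C(p, 2) = #|thick_index p|)%N.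
Proof.
rewrite -card_above_diagonal -(cardC [pred a : thick_index p | (coord2 a <= coord1 a)%N]).
by congr (_ + _)%N; apply: eq_card => a; rewrite !inE ltnNge.
Qed.
End Coordinates.

Section Eigenbasis.
Variables (K : comNzRingType) (p : nat) (A : 'M[K]_3).
(** The exponents are chosen so that for the cyclic permutation matrix this is the
    monomial whose exponents are the coordinates of [a]. *)
Definition eig_poly (a : thick_index p) : {poly {poly K}} :=
  let x := coord1 a in let y := coord2 a in
  if (y <= x)%N then row_monomial (cst2 A) 0 1 2 'X 'X%:P (p.-1 - x) (x - y) y
  else col_monomial (cst2 A) 0 1 2 'X 'X%:P (p.-1 - y) x (y - x).-1.
Definition eig_mx : 'M[K]_#|thick_index p| :=
  \matrix_a thick_vec p 0 1 2 (eig_poly (enum_val a)).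
Definition monodromy (s : seq (point p)) :=
  thick_part (block_prod A s) 0 1 *m thick_part (block_prod A s) 1 2
    *m thick_part (block_prod A s) 2 0.
End Eigenbasis.

Lemma eig_mxP (K : idomainType) p (A : 'M[K]_3) (s : seq (point p)) : p \in [pchar K] ->
  compatible_order s ->
  eig_mx p A *m monodromy A s = diag_mx (\row_a
     if (coord2 (enum_val a : thick_index p) <= coord1 (enum_val a))%N
     then A 0 1 ^+ p * A 1 2 ^+ p * A 2 0 ^+ p
     else A 0 2 ^+ p * A 2 1 ^+ p * A 1 0 ^+ p) *m eig_mx p A.
Proof.
move=> hp cs; have p_gt0 := prime_gt0 (pcharf_prime hp).
have crdp l b m : (line_coord l (b : thick_index p) 0 m < p)%N by rewrite /line_coord; case: unlift.
apply/row_matrixP => a; rewrite !row_mul row_diag_mx -scalemxAl -rowE !rowK mxE /monodromy /eig_poly.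
set x := coord1 _; set y := coord2 _; have ltx : (x < p)%N by apply: crdp.
have lty : (y < p)%N by apply: crdp.
case: leqP => [leyx|ltxy]; rewrite !mulmxA.
  rewrite (@row_monomial_step _ _ _ hp 0 1 2) // -?scalemxAl; last by lia.
  rewrite (@row_monomial_step _ _ _ hp 1 2 0) // -?scalemxAl; last by lia.
  rewrite (@row_monomial_step _ _ _ hp 2 0 1) //; last by lia.
  by rewrite !scalerA.
rewrite (@col_monomial_step _ _ _ hp 0 1 2) // -?scalemxAl; last by lia.
rewrite (@col_monomial_step _ _ _ hp 1 2 0) // -?scalemxAl; last by lia.
rewrite (@col_monomial_step _ _ _ hp 2 0 1) //; last by lia.
by rewrite !scalerA; congr (_ *: _); ring.
Qed.

(** * Specialization of the eigenvectors *)
Section BaseChange.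
Variables (K L : comNzRingType) (phi : {rmorphism K -> L}) (p : nat) (A : 'M[K]_3).

Lemma map_eig_poly a : map_poly (map_poly phi) (eig_poly A a) = eig_poly (p := p) (map_mx phi A) a.
Proof.
pose Phi : {rmorphism {poly {poly K}} -> {poly {poly L}}} := map_poly (map_poly phi).
have eA : map_mx Phi (cst2 A) = cst2 (map_mx phi A).
  by apply/matrixP => x y; rewrite !mxE /Phi /= map_polyC /= map_polyC.
have eX : Phi 'X = 'X by apply: map_polyX.
have eY : Phi 'X%:P = 'X%:P by rewrite /Phi /= map_polyC /= map_polyX.
rewrite /eig_poly; case: ifP => _.
  have := map_row_monomial Phi (cst2 A) 0 1 2 'X 'X%:P
    (p.-1 - coord1 a) (coord1 a - coord2 a) (coord2 a).
  by rewrite eA eX eY.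
have := map_col_monomial Phi (cst2 A) 0 1 2 'X 'X%:P
  (p.-1 - coord2 a) (coord1 a) (coord2 a - coord1 a).-1.
by rewrite eA eX eY.
Qed.

Lemma map_eig_mx : map_mx phi (eig_mx p A) = eig_mx p (map_mx phi A).
Proof. by apply/matrixP => a b; rewrite !mxE -map_eig_poly !coef_map. Qed.

Lemma map_thick_part (R : 'M[K]_#|line p|) i j :
  map_mx phi (thick_part R i j) = thick_part (map_mx phi R) i j.
Proof. by apply/matrixP => a b; rewrite !mxE. Qed.

Lemma map_block_prod s : map_mx phi (block_prod (p := p) A s) = block_prod (map_mx phi A) s.
Proof.
rewrite /block_prod; elim: s => [|x s IH]; first by rewrite !big_nil map_mx1.
rewrite !big_cons map_mxM IH; congr (_ *m _).
by apply/matrixP => a b; rewrite !mxE /=; case: ifP => _; rewrite ?mxE ?rmorph_nat.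
Qed.

Lemma map_monodromy (s : seq (point p)) : map_mx phi (monodromy A s) = monodromy (map_mx phi A) s.
Proof. by rewrite /monodromy !map_mxM !map_thick_part !map_block_prod. Qed.
End BaseChange.

Section CyclicPoint.
Variables (K : comNzRingType) (p : nat).

Definition cycle_mx : 'M[K]_3 := \matrix_(i, j) (j == i + 1)%:R.

Lemma eig_poly_cycle (a : thick_index p) :
  eig_poly cycle_mx a = 'X ^+ coord1 a * 'X%:P ^+ coord2 a.
Proof.
have E (i j : 'I_3) : cst2 cycle_mx i j = (j == i + 1)%:R by rewrite !mxE !rmorph_nat.
pose simp := (mulr0n, mulr1n, mulNr, mulr0, mul0r, mul1r, mulr1, oppr0, addr0,
              subr0, sub0r, opprK, expr1n).
rewrite /eig_poly; move: (coord1 a) (coord2 a) => x y.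
have [leyx|ltxy] := leqP y x.
  rewrite /row_monomial /diag_cof /off_cof !E /= !simp.
  by rewrite exprMn mulrCA -exprD subnK // mulrC.
rewrite /col_monomial /row_monomial /diag_cof /off_cof !mxE !rmorph_nat /=.
rewrite !simp.
rewrite exprMn -mulrA -exprD mulrCA -exprS; congr (_ * _ ^+ _).
by move: ltxy; lia.
Qed.

Lemma eig_mx_cycle : eig_mx p cycle_mx = 1%:M.
Proof.
apply/matrixP => a b; rewrite !mxE eig_poly_cycle -polyC_exp coefMC coefXn -/(coord1 _) -/(coord2 _).
have [->|nab] := eqVneq a b; first by rewrite eqxx mul1r coefXn eqxx.
case: eqP => [ex|_]; last by rewrite mul0r coef0.
rewrite mul1r coefXn; case: eqP => // ey; case/eqP: nab.
by apply: enum_val_inj; apply: coord_inj.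
Qed.
End CyclicPoint.

Section Spectrum.
Variables (F : fieldType) (p : nat) (A : 'M[F]_3) (s : seq (point p)).
Hypotheses (hp : p \in [pchar F]) (cs : compatible_order s).
Let lam := A 0 1 ^+ p * A 1 2 ^+ p * A 2 0 ^+ p.
Let mu := A 0 2 ^+ p * A 2 1 ^+ p * A 1 0 ^+ p.
Let M := monodromy A s.

(** A line in the space of matrices from [cycle_mx], where the eigenvectors are
    independent, to [A], where they may fail to be. *)
Definition pencil : 'M[{poly F}]_3 :=
  map_mx polyC (cycle_mx F) + 'X *: map_mx polyC (A - cycle_mx F).

Lemma pencil0 : map_mx (horner_eval 0) pencil = cycle_mx F.
Proof.
by apply/matrixP => i j; rewrite !mxE /horner_eval hornerD hornerM !hornerC hornerX mul0r addr0.
Qed.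

Lemma pencil1 : map_mx (horner_eval 1) pencil = A.
Proof.
by apply/matrixP => i j; rewrite !mxE /horner_eval hornerD hornerM !hornerC hornerX
  mul1r [LHS]addrC subrK.
Qed.

Lemma monodromy_spectrum :
  [/\ (\rank (M - lam%:M)%R <= 'C(p, 2))%N,
      (\rank (M - mu%:M)%R + 'C(p, 2) <= #|thick_index p|)%N &
      (M - lam%:M) *m (M - mu%:M) = 0].
Proof.
have hpt : p \in [pchar {poly F}] by rewrite pchar_poly.
have eig := eig_mxP pencil hpt cs.
set P := fun a : 'I_#|thick_index p| =>
  (coord2 (enum_val a : thick_index p) <= coord1 (enum_val a))%N in eig.
set l := pencil 0 1 ^+ p * _ * _ in eig; set m := pencil 0 2 ^+ p * _ * _ in eig.
have det0 : \det (map_mx (horner_eval 0) (eig_mx p pencil)) != 0.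
  by rewrite map_eig_mx pencil0 eig_mx_cycle det1 oner_neq0.
have entry i j : (pencil i j).[1] = A i j by rewrite -[in RHS]pencil1 [RHS]mxE.
have l1 : l.[1] = lam by rewrite /l !hornerM !horner_exp !entry.
have m1 : m.[1] = mu by rewrite /m !hornerM !horner_exp !entry.
have M1 : map_mx (horner_eval 1) (monodromy pencil s) = M.
  by rewrite map_monodromy pencil1.
have rk := mxrank_specialize_sub eig det0 1.
have := quadratic_specialize eig det0 1; rewrite M1 l1 m1 => quad.
have card_enum (Q : pred (thick_index p)) :
    #|[pred a : 'I_#|thick_index p| | Q (enum_val a)]| = #|Q|.
  rewrite -(card_image (@enum_val_inj _ (thick_index p))); apply: eq_card => a.
  apply/imageP/idP => [[b Qb ->]//|Qa]; exists (enum_rank a); rewrite ?enum_rankK //.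
  by rewrite inE enum_rankK.
split=> //.
  have := rk l; rewrite M1 l1 => /leq_trans; apply.
  rewrite -(card_above_diagonal p) -(card_enum (fun a => coord1 a < coord2 a)%N).
  apply/subset_leq_card/subsetP => a.
  by rewrite !inE /P ltnNge; case: ifP => //; rewrite eqxx.
rewrite -[leqRHS](card_below_diagonal p) leq_add2r -(card_enum (fun a => coord2 a <= coord1 a)%N).
have := rk m; rewrite M1 m1 => /leq_trans; apply.
apply/subset_leq_card/subsetP => a.
by rewrite !inE /P; case: ifP => //; rewrite eqxx.
Qed.
End Spectrum.

(** * The Jordan form *)
Theorem theorem8 (F : fieldType) (p : nat) (hp : p \in [pchar F])
    (A : 'M[F]_3) (R : 'M[F]_#|line p|) (hR : is_block A R) :
  let M := thick_block R 0 1 *m thick_block R 1 2 *m thick_block R 2 0 in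
  let lam := A 0 1 ^+ p * A 1 2 ^+ p * A 2 0 ^+ p in
  let mu := A 0 2 ^+ p * A 2 1 ^+ p * A 1 0 ^+ p in
  exists s t : seq nat,
    [/\ sumn s = (p * (p + 1) %/ 2)%N,
        sumn t = (p * (p - 1) %/ 2)%N,
        jordan_form M ([seq (lam, n) | n <- s] ++ [seq (mu, n) | n <- t]) &
        A 0 1 * A 1 2 * A 2 0 <> A 0 2 * A 2 1 * A 1 0 ->
          diagonalizable M /\ all (pred1 1%N) (s ++ t)].
Proof.
have [s cs defR] := hR => M lam mu.
have defM : M = monodromy A s by rewrite /M defR.
have p_gt1 := prime_gt1 (pcharf_prime hp).
set n := (p * (p + 1) %/ 2)%N; set m := (p * (p - 1) %/ 2)%N.
have em : 'C(p, 2) = m by rewrite bin2 /m subn1 divn2.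
have dimN : #|thick_index p| = (n + m)%N.
  rewrite card_ffun !card_ord /n /m -divnDl ?dvdn2 ?oddM ?oddD; last first.
    by case: (odd p).
  by rewrite -mulnDr (_ : p + 1 + (p - 1) = p * 2)%N ?mulnA ?mulnK //; lia.
have gap : (m + 2 <= n)%N.
  have -> : n = (m + p)%N by rewrite addnC /n /m -divnMDl //; congr (_ %/ 2)%N; nia.
  by rewrite leq_add2l.
have [] := monodromy_spectrum A hp cs; rewrite -/lam -/mu -defM em => rk_lam rk_mu quad.
have {}rk_mu : (\rank (M - mu%:M)%R <= n)%N.
  by move: rk_mu; rewrite [leqRHS]dimN leq_add2r.
(* Frobenius is injective, so equal eigenvalues contradict the hypothesis of the
   last claim. *)
have [elm|nlm] := eqVneq lam mu.
  have [s' [t' [es et jf]]] := jordan_square_zero dimN rk_lam elm quad gap.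
  exists s', t'; split=> // /eqP; case/negP; rewrite -(inj_eq (fmorph_inj (pFrobenius_aut hp))).
  by rewrite !rmorphM /= !pFrobenius_autE -/lam -/mu elm.
have [jf dg] := jordan_two_eigenvalues dimN rk_lam rk_mu nlm.
exists (nseq n 1%N), (nseq m 1%N); rewrite !sumn_nseq !mul1n; split=> // _.
by split=> //; rewrite all_cat !all_nseq /= !orbT.
Qed.
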